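(* Let $n\ge1$, let $H\in\mathbb{R}^{n\times n}$ be symmetric positive definite, $\delta>0$, $b\in\mathbb{R}^n\setminus\{0\}$, and $\beta=\sqrt{b^{\mathsf T}H^{-1}b}>0$. For $\tau>0$ set $a_\tau=\beta+\tau$ and $\Delta_\tau=\sqrt{a_\tau^2-\beta^2}=\sqrt{2\beta\tau+\tau^2}$, and let $(t_\tau,z_\tau)$ be the unique minimizer of $$(P_{a_\tau,b}^{\delta,H})\qquad\inf\left\{a_\tau t+b^{\mathsf T}z:\ (t,z)\in\mathbb{R}\times\mathbb{R}^n,\ t\ge\sqrt{\delta^2+z^{\mathsf T}Hz}\right\}.$$ Let $\rho_H(z)=\sqrt{z^{\mathsf T}Hz}$. As $\tau\downarrow0$, $$\operatorname{val}(P_{a_\tau,b}^{\delta,H})=\delta\Delta_\tau=\delta\sqrt{2\beta\tau}\,\bigl(1+O(\tau/\beta)\bigr),$$ $$\rho_H(z_\tau)=\frac{\delta\beta}{\Delta_\tau}=\delta\sqrt{\frac{\beta}{2\tau}}\,\bigl(1+O(\tau/\beta)\bigr),$$ $$t_\tau=\frac{\delta(\beta+\tau)}{\Delta_\tau}=\delta\sqrt{\frac{\beta}{2\tau}}\,\bigl(1+O(\tau/\beta)\bigr).$$ Moreover, if $\ell_0(t,z)=\beta t+b^{\mathsf T}z$ is the boundary objective, then $$\ell_0(t_\tau,z_\tau)=\frac{\beta\delta\tau}{\Delta_\tau}=\delta\sqrt{\frac{\beta\tau}{2}}\,\bigl(1+O(\tau/\beta)\bigr).$$ Thus a small objective tilt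 of size $\tau$ produces an $O(\sqrt\tau)$ boundary residual but an $O(\tau^{-1/2})$ decision magnitude.
   Context: $\operatorname{val}$ denotes the optimal value. Here $\beta>0$ is fixed, so that $O(\tau/\beta)$ and $O(\tau)$ are equivalent as $\tau\downarrow0$. For $a_\tau>\beta$ the problem has a unique minimizer. *)

(* Defs.v *)
From mathcomp Require Import all_boot all_order all_algebra.
From mathcomp Require Import all_classical all_reals all_analysis.
Import Order.TTheory GRing.Theory Num.Theory.
Import numFieldNormedType.Exports.
Set Implicit Arguments.
Unset Strict Implicit.
Unset Printing Implicit Defensive.

Local Open Scope classical_set_scope.
Local Open Scope ring_scope.

Definition dotv (R : realType) (n : nat) (x y : 'cV[R]_n) : R := (x^T *m y) 0 0.

Definition quad (R : realType) (n : nat) (M : 'M[R]_n) (x : 'cV[R]_n) : R :=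
  (x^T *m M *m x) 0 0.

Definition sym_posdef (R : realType) (n : nat) (M : 'M[R]_n) : Prop :=
  M^T = M /\ forall x : 'cV[R]_n, x != 0 -> 0 < quad M x.

                              
Definition rho (R : realType) (n : nat) (M : 'M[R]_n) (x : 'cV[R]_n) : R :=
  Num.sqrt (quad M x).

Definition objective (R : realType) (n : nat) (a : R) (b : 'cV[R]_n)
    (p : R * 'cV[R]_n) : R :=
  a * p.1 + dotv b p.2.

Definition feasible (R : realType) (n : nat) (delta : R) (H : 'M[R]_n) :
    set (R * 'cV[R]_n) :=
  [set p | p.1 >= Num.sqrt (delta ^+ 2 + quad H p.2)].

                                                                               
Definition optval (R : realType) (n : nat) (a : R) (b : 'cV[R]_n) (delta : R)
    (H : 'M[R]_n) : \bar R :=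
  ereal_inf [set (objective a b p)%:E | p in feasible delta H].

Definition minimizer (R : realType) (n : nat) (a : R) (b : 'cV[R]_n) (delta : R)
    (H : 'M[R]_n) (p : R * 'cV[R]_n) : Prop :=
  feasible delta H p /\
  forall q, feasible delta H q -> objective a b p <= objective a b q.

                                                          
Definition eq_mul_1DbigO (R : realType) (f g h : R -> R) : Prop :=
  exists2 e : R -> R, e =O_ (0^'+) h &
    \forall tau \near 0^'+, f tau = g tau * (1 + e tau).

(* Main.v *)
(* For feasible (t, z), Cauchy-Schwarz in the H-inner product gives
   (b^T z)^2 <= beta^2 (t^2 - delta^2). With v = a t + b^T z and D^2 = a^2 - beta^2
   this reads (D^2 t - a v)^2 <= beta^2 (v^2 - delta^2 D^2), so v >= delta D, and
   equality forces t = delta a / D and then z = - (delta / D) H^-1 b.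
   The expansions follow from D = sqrt (2 beta tau) * s with
   s = sqrt (1 + tau / (2 beta)): the relative errors s - 1, 1/s - 1 and
   (1 + tau / beta) / s - 1 are all at most tau / beta in absolute value. *)
Require Import Defs.
From mathcomp Require Import all_boot all_order all_algebra.
From mathcomp Require Import all_classical all_reals all_analysis.
From mathcomp Require Import ring lra.
Import Order.TTheory GRing.Theory Num.Theory.
Import numFieldNormedType.Exports.
Set Implicit Arguments.
Unset Strict Implicit.
Unset Printing Implicit Defensive.
Local Open Scope classical_set_scope.
Local Open Scope ring_scope.

(** * Quadratic forms, Cauchy-Schwarz and the inverse of [H] *)

Lemma quad_ge0 (R : realType) n (H : 'M[R]_n) (x : 'cV[R]_n) :
  sym_posdef H -> 0 <= quad H x.
Proof.
move=> [_ posH]; have [->|/posH/ltW//] := eqVneq x 0.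
by rewrite /quad mulmx0 mxE.
Qed.

Lemma quad_eq0 (R : realType) n (H : 'M[R]_n) (x : 'cV[R]_n) :
  sym_posdef H -> quad H x = 0 -> x = 0.
Proof.
by move=> [_ posH] x0; apply/eqP; apply: contraT => /posH; rewrite x0 ltxx.
Qed.

Lemma dotvDr (R : realType) n (b x y : 'cV[R]_n) :
  dotv b (x + y) = dotv b x + dotv b y.
Proof. by rewrite /dotv mulmxDr mxE. Qed.

Lemma dotvZr (R : realType) n (b x : 'cV[R]_n) (k : R) :
  dotv b (k *: x) = k * dotv b x.
Proof. by rewrite /dotv -scalemxAr mxE. Qed.

Lemma dotvC (R : realType) n (x y : 'cV[R]_n) : dotv x y = dotv y x.
Proof.
by rewrite /dotv !mxE; apply: eq_bigr => i _; rewrite !mxE mulrC.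
Qed.

Lemma quad_dotv (R : realType) n (H : 'M[R]_n) (x : 'cV[R]_n) :
  sym_posdef H -> quad H x = dotv (H *m x) x.
Proof. by move=> [symH _]; rewrite /dotv /quad trmx_mul symH. Qed.

Lemma dotv_mulmxC (R : realType) n (H : 'M[R]_n) (x y : 'cV[R]_n) :
  sym_posdef H -> dotv (H *m x) y = dotv (H *m y) x.
Proof.
by move=> [symH _]; rewrite dotvC /dotv trmx_mul symH mulmxA.
Qed.

Lemma quadDZ (R : realType) n (H : 'M[R]_n) (x y : 'cV[R]_n) (k l : R) :
  sym_posdef H ->
  quad H (k *: x + l *: y) =
    k ^+ 2 * quad H x + 2 * k * l * dotv (H *m y) x + l ^+ 2 * quad H y.
Proof.
move=> hH; rewrite !quad_dotv//.
(* Symmetry of [H] moves the remaining sum to the right argument, where linearity applies again. *)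
rewrite dotvDr !dotvZr ![dotv (_ *m (_ + _)) _]dotv_mulmxC// !dotvDr !dotvZr.
by rewrite (dotv_mulmxC y x hH); ring.
Qed.

(** With [c = dotv (H *m y) x], positivity is applied to [quad H y *: x - c *: y], the residual of
    projecting [x] onto [y] scaled to avoid division. *)
Lemma cauchy_schwarz (R : realType) n (H : 'M[R]_n) (x y : 'cV[R]_n) :
  sym_posdef H -> dotv (H *m y) x ^+ 2 <= quad H y * quad H x.
Proof.
move=> hH; have [->|y0] := eqVneq y 0.
  by rewrite mulmx0 dotvC /dotv mulmx0 mxE expr0n /quad mulmx0 mxE mul0r.
have qy : 0 < quad H y by apply: hH.2.
have := quad_ge0 (quad H y *: x + (- dotv (H *m y) x) *: y) hH.
rewrite quadDZ//; set c := dotv _ _; set q := quad H y; set r := quad H x.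
have -> : q ^+ 2 * r + 2 * q * - c * c + (- c) ^+ 2 * q = q * (q * r - c ^+ 2).
  by ring.
by rewrite pmulr_rge0// subr_ge0.
Qed.

(** A nonzero left-kernel vector would have a vanishing quadratic form. *)
Lemma sym_posdef_unitmx (R : realType) n (H : 'M[R]_n) :
  sym_posdef H -> H \in unitmx.
Proof.
move=> hH; rewrite unitmxE unitfE; apply/det0P => -[v v0 vH0].
suff : v^T = 0 by move/(canRL (@trmxK _ _ _)); rewrite trmx0; apply/eqP.
by apply: (quad_eq0 hH); rewrite /quad trmxK vH0 mul0mx mxE.
Qed.

(** Since [b = H w] for [w = H^-1 b], beta^2 is the squared [H]-norm of [w]; facts about [invmx H]
    thus reduce to definiteness of [H] itself. *)
Lemma quad_invmx (R : realType) n (H : 'M[R]_n) (b : 'cV[R]_n) :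
  sym_posdef H -> quad (invmx H) b = quad H (invmx H *m b).
Proof.
move=> hH; rewrite [RHS]quad_dotv// mulKVmx ?sym_posdef_unitmx//.
by rewrite /dotv /quad mulmxA.
Qed.

Lemma quad_invmx_gt0 (R : realType) n (H : 'M[R]_n) (b : 'cV[R]_n) :
  sym_posdef H -> b != 0 -> 0 < quad (invmx H) b.
Proof.
move=> hH b0; rewrite quad_invmx//; apply: hH.2; apply: contra_neq b0 => w0.
by rewrite -[b](mulKVmx (sym_posdef_unitmx hH)) w0 mulmx0.
Qed.

Lemma cauchy_schwarz_invmx (R : realType) n (H : 'M[R]_n) (b z : 'cV[R]_n) :
  sym_posdef H -> dotv b z ^+ 2 <= quad (invmx H) b * quad H z.
Proof.
move=> hH; rewrite quad_invmx//.
by rewrite -{1}[b](mulKVmx (sym_posdef_unitmx hH)) cauchy_schwarz.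
Qed.

(** * The feasible set and the key quadratic inequality *)

(** Trades the square root for a polynomial inequality; the sign of [p.1] is kept because squaring
    would lose it. *)
Lemma feasibleP (R : realType) n (delta : R) (H : 'M[R]_n) (p : R * 'cV[R]_n) :
  sym_posdef H ->
  feasible delta H p <-> 0 <= p.1 /\ delta ^+ 2 + quad H p.2 <= p.1 ^+ 2.
Proof.
move=> hH; have q0 : 0 <= delta ^+ 2 + quad H p.2.
  by rewrite addr_ge0 ?sqr_ge0 ?quad_ge0.
rewrite /feasible/=; split=> [pf|[p0 pq]].
  have p0 := le_trans (sqrtr_ge0 _) pf; split=> //.
  by rewrite -[leLHS]sqr_sqrtr// ler_sqr ?nnegrE.
by rewrite -(ger0_norm p0) -sqrtr_sqr ler_wsqrtr.
Qed.

(* Eliminate [z] by Cauchy-Schwarz, [(b^T z)^2 <= beta^2 (t^2 - delta^2)], and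
   complete the square in [t]. *)
Lemma objective_square_bound (R : realType) n (delta a : R) (H : 'M[R]_n)
    (b : 'cV[R]_n) (p : R * 'cV[R]_n) :
  sym_posdef H -> quad (invmx H) b <= a ^+ 2 -> feasible delta H p ->
  let beta2 := quad (invmx H) b in
  let v := objective a b p in
  ((a ^+ 2 - beta2) * p.1 - a * v) ^+ 2
    <= beta2 * (v ^+ 2 - delta ^+ 2 * (a ^+ 2 - beta2)).
Proof.
move=> hH ltBa /(feasibleP _ _ hH)[p0 pq] /=.
have := cauchy_schwarz_invmx b p.2 hH.
have : 0 <= quad (invmx H) b by rewrite quad_invmx// quad_ge0.
rewrite /objective; case: p p0 pq ltBa => t z /=.
move: (quad H z) (dotv b z) (quad _ b) => q c B t0 tq leBa B0 cB.
have cB' : c ^+ 2 <= B * (t ^+ 2 - delta ^+ 2).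
  by apply: (le_trans cB); rewrite ler_wpM2l//; lra.
rewrite -subr_ge0.
(* The gap between the two sides is exactly [a ^+ 2 - B] times the Cauchy-Schwarz gap. *)
have -> : B * ((a * t + c) ^+ 2 - delta ^+ 2 * (a ^+ 2 - B)) -
  ((a ^+ 2 - B) * t - a * (a * t + c)) ^+ 2 =
  (a ^+ 2 - B) * (B * (t ^+ 2 - delta ^+ 2) - c ^+ 2) by ring.
by rewrite mulr_ge0 ?subr_ge0.
Qed.

(** * The explicit minimizer, its value and its uniqueness *)

Definition opt_point (R : realType) n (delta a : R) (H : 'M[R]_n)
    (b : 'cV[R]_n) : R * 'cV[R]_n :=
  let D := Num.sqrt (a ^+ 2 - quad (invmx H) b) in
  (delta * a / D, - (delta / D) *: (invmx H *m b)).

Section OptPoint.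
Variables (R : realType) (n : nat) (delta a : R) (H : 'M[R]_n) (b : 'cV[R]_n).
Hypotheses (hH : sym_posdef H) (b0 : b != 0) (delta0 : 0 < delta) (a0 : 0 < a).
Hypothesis lt_ba : quad (invmx H) b < a ^+ 2.
Let B := quad (invmx H) b.
Let D := Num.sqrt (a ^+ 2 - B).

Let D0 : 0 < D. Proof. by rewrite sqrtr_gt0 subr_gt0. Qed.
Let sqrD : D ^+ 2 = a ^+ 2 - B.
Proof. by rewrite sqr_sqrtr// subr_ge0 ltW. Qed.

Lemma quad_opt_point : quad H (opt_point delta a H b).2 = (delta / D) ^+ 2 * B.
Proof.
have := quadDZ 0 (invmx H *m b) 0 (- (delta / D)) hH.
by rewrite scale0r add0r => ->; rewrite -quad_invmx// -/B; ring.
Qed.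

Lemma dotv_opt_point : dotv b (opt_point delta a H b).2 = - (delta / D) * B.
Proof. by rewrite dotvZr /B /quad /dotv mulmxA. Qed.

Lemma feasible_opt_point : feasible delta H (opt_point delta a H b).
Proof.
apply/(feasibleP _ _ hH); split; first by rewrite /= !mulr_ge0 ?invr_ge0 ?ltW.
(* Eliminating [B] in favour of [D] leaves an identity of rational functions: the constraint is
   active at this point. *)
rewrite quad_opt_point /= -/B -/D; have -> : B = a ^+ 2 - D ^+ 2.
  by rewrite sqrD; ring.
by rewrite le_eqVlt; apply/orP; left; apply/eqP; field; rewrite gt_eqF.
Qed.

Lemma objective_opt_point :
  objective a b (opt_point delta a H b) = delta * D.
Proof.
rewrite /objective dotv_opt_point /= -/B -/D; have -> : B = a ^+ 2 - D ^+ 2.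
  by rewrite sqrD; ring.
by field; rewrite gt_eqF.
Qed.

(** [objective_square_bound] only controls the square of the objective, so nonnegativity comes
    first: (b^T z)^2 <= B z^T H z <= a^2 t^2 gives |b^T z| <= a t. Then the left-hand square is
    dropped and [B > 0] cancelled. *)
Lemma objective_ge p : feasible delta H p -> delta * D <= objective a b p.
Proof.
move=> pf; have [p0 pq] := (feasibleP _ _ hH).1 pf.
have v0 : 0 <= objective a b p.
  have : `|dotv b p.2| <= a * p.1.
    have ap0 : 0 <= a * p.1 by rewrite mulr_ge0 ?(ltW a0).
    rewrite -sqrtr_sqr -[leRHS](ger0_norm ap0) -[leRHS]sqrtr_sqr ler_wsqrtr//.
    apply: (le_trans (cauchy_schwarz_invmx _ _ hH)).
    rewrite exprMn ler_pM ?(quad_ge0 _ hH) ?(ltW lt_ba) ?(ltW (quad_invmx_gt0 _ _))//.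
    by apply: le_trans pq; rewrite lerDr sqr_ge0.
  by rewrite ler_norml /objective; lra.
rewrite -ler_sqr ?nnegrE ?mulr_ge0 ?(ltW delta0) ?(ltW D0)//.
rewrite exprMn sqrD.
have := objective_square_bound hH (ltW lt_ba) pf.
by move/(le_trans (sqr_ge0 _)); rewrite pmulr_rge0 ?quad_invmx_gt0// subr_ge0.
Qed.

Lemma objective_le_opt_point p :
  feasible delta H p -> objective a b p <= delta * D -> p = opt_point delta a H b.
Proof.
move=> pf le_pD.
have vE : objective a b p = delta * D by apply/le_anti; rewrite le_pD objective_ge.
have [p0 pq] := (feasibleP _ _ hH).1 pf.
have tE : p.1 = delta * a / D.
  (* At the value [delta * D] the right-hand side of the bound vanishes, hence so does the square
     containing [p.1]. *)
  have /= := objective_square_bound hH (ltW lt_ba) pf.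
  rewrite -/B vE -sqrD exprMn subrr mulr0 => sq0.
  have /eqP : (D ^+ 2 * p.1 - a * (delta * D)) ^+ 2 = 0.
    by apply/le_anti; rewrite sq0 sqr_ge0.
  rewrite sqrf_eq0 subr_eq0 => /eqP DtE.
  have D2 : D ^+ 2 != 0 by rewrite expf_neq0// gt_eqF.
  by apply: (mulfI D2); rewrite DtE; field; rewrite gt_eqF.
have cE : dotv b p.2 = - (delta / D) * B.
  have -> : dotv b p.2 = objective a b p - a * p.1 by rewrite /objective; ring.
  by rewrite vE tE; have -> : B = a ^+ 2 - D ^+ 2; [rewrite sqrD; ring|field; rewrite gt_eqF].
case: p tE cE pf vE pq {p0 le_pD} => t z /= -> cE _ _ tq.
rewrite /opt_point -/B -/D; congr pair; apply/eqP; rewrite scaleNr -addr_eq0; apply/eqP.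
(* With l = delta / D and the known value of b^T z, the form at z + l H^-1 b equals [quad H z] - l^2
   B, which feasibility makes nonpositive; definiteness concludes. *)
apply: (quad_eq0 hH); rewrite -[z]scale1r.
apply/le_anti; rewrite quad_ge0// andbT quadDZ// -quad_invmx//.
rewrite mulKVmx ?sym_posdef_unitmx// cE -/B.
move: tq; have -> : (delta * a / D) ^+ 2 = delta ^+ 2 + (delta / D) ^+ 2 * B.
  by have -> : B = a ^+ 2 - D ^+ 2; [rewrite sqrD; ring|field; rewrite gt_eqF].
by rewrite lerD2l; move: (delta / D) (quad H z) => l q; nra.
Qed.

Lemma minimizer_opt_point p :
  minimizer a b delta H p <-> p = opt_point delta a H b.
Proof.
split=> [[pf pmin]|->].
  apply: objective_le_opt_point => //; rewrite -objective_opt_point.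
  exact/pmin/feasible_opt_point.
split=> [|q qf]; first exact: feasible_opt_point.
by rewrite objective_opt_point objective_ge.
Qed.

Lemma optval_opt_point : optval a b delta H = (delta * D)%:E.
Proof.
apply/le_anti/andP; split.
  rewrite -objective_opt_point; apply: ereal_inf_lbound.
  by exists (opt_point delta a H b) => //; exact: feasible_opt_point.
by apply: le_ereal_inf_tmp => _ [p pf <-]; rewrite lee_fin objective_ge.
Qed.

Lemma rho_opt_point : rho H (opt_point delta a H b).2 = delta * Num.sqrt B / D.
Proof.
rewrite /rho quad_opt_point sqrtrM ?sqr_ge0// sqrtr_sqr ger0_norm.
  by rewrite mulrAC.
by rewrite divr_ge0 ?ltW.
Qed.

End OptPoint.

(** * From relative error bounds to asymptotic statements *)

Lemma sqrtr_eq (R : rcfType) (x y : R) : 0 <= y -> y ^+ 2 = x -> Num.sqrt x = y.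
Proof. by move=> y0 <-; rewrite sqrtr_sqr ger0_norm. Qed.

Section RelativeError.
Variables (R : realType) (beta : R) (f g e : R -> R).
Hypothesis beta0 : 0 < beta.
Hypothesis fE : forall tau, 0 < tau -> f tau = g tau * (1 + e tau).
Hypothesis e_le : forall tau, 0 < tau -> `|e tau| <= tau / beta.

Lemma relative_error_eq_mul : eq_mul_1DbigO f g (fun tau => tau / beta).
Proof.
exists e; last by near=> tau; apply: fE.
apply/eqO_exP; exists 1 => //; near=> tau.
have tau0 : 0 < tau by [].
by rewrite mul1r [leRHS]ger0_norm ?e_le// divr_ge0 ?ltW.
Unshelve. all: by end_near. Qed.

Lemma relative_error_bigO (C : R) (k : R -> R) :
  (forall tau, 0 < tau -> g tau = C * k tau) -> f =O_ (0^'+) k.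
Proof.
(* The factor 2 bounds [|1 + e tau|] once [tau <= beta]; the added 1 keeps the constant positive
   even if [C = 0]. *)
move=> gE; apply/eqO_exP; exists (`|C| * 2 + 1); first by rewrite ltr_wpDl.
near=> tau; have tau0 : 0 < tau by [].
rewrite fE// gE// !normrM mulrAC ler_wpM2r//.
have : `|1 + e tau| <= 2.
  apply: (le_trans (ler_normD _ _)); rewrite normr1 -[leRHS]/(1 + 1) lerD2l.
  apply: (le_trans (e_le tau0)); rewrite ler_pdivrMr// mul1r.
  by near: tau; exact: nbhs_right_le.
by move=> /(ler_wpM2l (normr_ge0 C)) /le_trans; apply; rewrite lerDl.
Unshelve. all: by end_near. Qed.

End RelativeError.

(** * Square roots in the tilt and their relative errors *)

Section TiltExpansion.
Variables (R : realType) (beta tau : R).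
Hypotheses (beta0 : 0 < beta) (tau0 : 0 < tau).
Let s := Num.sqrt (1 + tau / beta / 2).
Let x := tau / beta.

Let x0 : 0 < x. Proof. by rewrite divr_gt0. Qed.

Lemma tilt_sqrt_ge1 : 1 <= s.
Proof. by rewrite -[leLHS]sqrtr1 ler_wsqrtr// lerDl divr_ge0 ?ltW. Qed.

Lemma sqr_tilt_sqrt : s ^+ 2 = 1 + x / 2.
Proof. by rewrite sqr_sqrtr// addr_ge0// divr_ge0 ?ltW. Qed.

(** As [s >= 1], s <= s^2 = 1 + x/2 <= 1 + x. *)
Let s_le : s <= 1 + x.
Proof. by have := tilt_sqrt_ge1; have := sqr_tilt_sqrt; have := x0; nra. Qed.

Let s0 : 0 < s. Proof. exact: lt_le_trans tilt_sqrt_ge1. Qed.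

Lemma tilt_sqrt_error : `|s - 1| <= x.
Proof. by rewrite ger0_norm ?subr_ge0 ?tilt_sqrt_ge1// lerBlDl. Qed.

Lemma tilt_invsqrt_error : `|s^-1 - 1| <= x.
Proof.
have sV1 : s^-1 <= 1 by rewrite invf_le1// tilt_sqrt_ge1.
rewrite ler0_norm ?subr_le0// opprB lerBlDr.
(* Multiplied by [s], the claim reads s <= x s + 1, which follows from s <= 1 + x and s >= 1. *)
rewrite -(ler_pM2r s0) mulrDl mulVf ?gt_eqF//.
by have := tilt_sqrt_ge1; have := s_le; have := x0; nra.
Qed.

(** [s <= 1 + x] puts the ratio above 1, and [s >= 1] keeps it below [1 + x]. *)
Lemma tilt_ratio_error : `|(1 + x) / s - 1| <= x.
Proof.
have ratio1 : 1 <= (1 + x) / s by rewrite ler_pdivlMr// mul1r.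
rewrite ger0_norm ?subr_ge0// lerBlDl ler_pdivrMr//.
by rewrite ler_peMr ?tilt_sqrt_ge1// addr_ge0// ltW.
Qed.

Lemma tilt_DeltaE :
  Num.sqrt ((beta + tau) ^+ 2 - beta ^+ 2) = Num.sqrt (2 * beta * tau) * s.
Proof.
rewrite -sqrtrM ?mulr_ge0 ?(ltW beta0) ?(ltW tau0)//.
by congr Num.sqrt; field; rewrite gt_eqF.
Qed.

(** Expresses the leading term through the radical of [tilt_DeltaE], so that comparison with the
    exact formula is rational in that radical. *)
Lemma sqrt_beta_div : Num.sqrt (beta / (2 * tau)) = beta / Num.sqrt (2 * beta * tau).
Proof.
apply: sqrtr_eq; first by rewrite divr_ge0 ?sqrtr_ge0 ?ltW.
rewrite expr_div_n sqr_sqrtr ?mulr_ge0 ?(ltW beta0) ?(ltW tau0)//.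
by field; rewrite !gt_eqF.
Qed.

Lemma sqrt_beta_mul :
  Num.sqrt (beta * tau / 2) = beta * tau / Num.sqrt (2 * beta * tau).
Proof.
apply: sqrtr_eq; first by rewrite divr_ge0 ?sqrtr_ge0 ?mulr_ge0 ?ltW.
rewrite expr_div_n sqr_sqrtr ?mulr_ge0 ?(ltW beta0) ?(ltW tau0)//.
by field; rewrite !gt_eqF.
Qed.

(** Separates the constant from the power of [tau], the shape [C * k tau] asked by
    [relative_error_bigO]. *)
Lemma sqrt_beta_div_split :
  Num.sqrt (beta / (2 * tau)) = Num.sqrt (beta / 2) * (Num.sqrt tau)^-1.
Proof.
rewrite -sqrtrV ?(ltW tau0)// -sqrtrM ?divr_ge0 ?(ltW beta0)//.
by rewrite invfM mulrA.
Qed.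

Lemma sqrt_beta_mul_split :
  Num.sqrt (beta * tau / 2) = Num.sqrt (beta / 2) * Num.sqrt tau.
Proof. by rewrite -sqrtrM ?divr_ge0 ?(ltW beta0)// mulrAC. Qed.

End TiltExpansion.

(** * The tilted family: exact formulas, expansions and rates *)

Theorem theorem8p1 (R : realType) (n : nat) (hn : (1 <= n)%N) (H : 'M[R]_n)
    (hH : sym_posdef H) (delta : R) (hdelta : 0 < delta)
    (b : 'cV[R]_n) (hb : b != 0) :
  let beta : R := Num.sqrt (quad (invmx H) b) in
  let a (tau : R) : R := beta + tau in
  let Delta (tau : R) : R := Num.sqrt (a tau ^+ 2 - beta ^+ 2) in
  [/\ 0 < beta,
      forall tau : R, 0 < tau -> Delta tau = Num.sqrt (2 * beta * tau + tau ^+ 2),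
      forall tau : R, 0 < tau ->
        exists! p : R * 'cV[R]_n, minimizer (a tau) b delta H p
    & forall (t : R -> R) (z : R -> 'cV[R]_n),
      (forall tau : R, 0 < tau -> minimizer (a tau) b delta H (t tau, z tau)) ->
      [/\ (forall tau : R, 0 < tau ->
             optval (a tau) b delta H = (delta * Delta tau)%:E) /\
          eq_mul_1DbigO (fun tau => fine (optval (a tau) b delta H))
            (fun tau => delta * Num.sqrt (2 * beta * tau)) (fun tau => tau / beta),
          (forall tau : R, 0 < tau ->
             rho H (z tau) = delta * beta / Delta tau) /\
          eq_mul_1DbigO (fun tau => rho H (z tau))
            (fun tau => delta * Num.sqrt (beta / (2 * tau))) (fun tau => tau / beta),
          (forall tau : R, 0 < tau ->
             t tau = delta * (beta + tau) / Delta tau) /\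
          eq_mul_1DbigO t
            (fun tau => delta * Num.sqrt (beta / (2 * tau))) (fun tau => tau / beta),
          (forall tau : R, 0 < tau ->
             objective beta b (t tau, z tau) = beta * delta * tau / Delta tau) /\
          eq_mul_1DbigO (fun tau => objective beta b (t tau, z tau))
            (fun tau => delta * Num.sqrt (beta * tau / 2)) (fun tau => tau / beta)
        & [/\ (fun tau => objective beta b (t tau, z tau)) =O_ (0^'+) (fun tau : R => Num.sqrt tau),
              (fun tau => rho H (z tau)) =O_ (0^'+) (fun tau : R => (Num.sqrt tau)^-1)
            & t =O_ (0^'+) (fun tau : R => (Num.sqrt tau)^-1)]]].
Proof.
move=> beta a Delta.
have B0 : 0 < quad (invmx H) b by exact: quad_invmx_gt0.
have beta0 : 0 < beta by rewrite sqrtr_gt0.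
have sqrb : quad (invmx H) b = beta ^+ 2 by rewrite sqr_sqrtr// ltW.
have a0 tau : 0 < tau -> 0 < a tau by move=> tau0; rewrite addr_gt0.
have lt_ba tau : 0 < tau -> quad (invmx H) b < a tau ^+ 2.
  by move=> tau0; rewrite sqrb ltr_sqr ?nnegrE ?ltrDl ?ltW// a0.
have DE tau : Num.sqrt (a tau ^+ 2 - quad (invmx H) b) = Delta tau.
  by rewrite sqrb.
have D0 tau : 0 < tau -> 0 < Delta tau.
  by move=> tau0; rewrite -DE sqrtr_gt0 subr_gt0 lt_ba.
split=> //.
- by move=> tau _; congr Num.sqrt; rewrite /a; ring.
- move=> tau tau0; exists (opt_point delta (a tau) H b).
  have minE p := minimizer_opt_point hH hb hdelta (a0 _ tau0) (lt_ba _ tau0) p.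
  by split=> [|p /minE //]; apply/minE.
move=> t z tzmin.
(* Uniqueness identifies any selection of minimizers with the explicit one. *)
have tzE tau : 0 < tau -> (t tau, z tau) = opt_point delta (a tau) H b.
  move=> tau0; apply/(minimizer_opt_point hH hb hdelta (a0 _ tau0) (lt_ba _ tau0)).
  exact: tzmin.
have valE tau : 0 < tau -> optval (a tau) b delta H = (delta * Delta tau)%:E.
  move=> tau0; rewrite -DE.
  exact: (optval_opt_point hH hb hdelta (a0 _ tau0) (lt_ba _ tau0)).
have rhoE tau : 0 < tau -> rho H (z tau) = delta * beta / Delta tau.
  move=> tau0; rewrite -DE -[z tau]/((t tau, z tau).2) tzE//.
  exact: (rho_opt_point hH hdelta (lt_ba _ tau0)).
have tE tau : 0 < tau -> t tau = delta * (beta + tau) / Delta tau.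
  by move=> tau0; rewrite -[t tau]/((t tau, z tau).1) tzE// -DE.
have objE tau : 0 < tau ->
    objective beta b (t tau, z tau) = beta * delta * tau / Delta tau.
  (* The beta^2 contributions of the two terms cancel, leaving only the part proportional to
     [tau]. *)
  move=> tau0; rewrite tzE// /objective dotv_opt_point /= DE sqrb /a.
  by field; rewrite gt_eqF ?D0.
pose s tau := Num.sqrt (1 + tau / beta / 2).
have s0 tau : 0 < tau -> s tau != 0.
  by move=> tau0; rewrite gt_eqF// (lt_le_trans _ (tilt_sqrt_ge1 beta0 tau0)).
have r0 tau : 0 < tau -> Num.sqrt (2 * beta * tau) != 0.
  by move=> tau0; rewrite gt_eqF// sqrtr_gt0 !mulr_gt0.
have DsE tau : 0 < tau -> Delta tau = Num.sqrt (2 * beta * tau) * s tau.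
  exact: tilt_DeltaE.
(* Each quantity is its leading term times an exact factor, s, 1/s or (1 + tau/beta)/s, written as
   one plus an error. *)
have val_rel tau : 0 < tau -> fine (optval (a tau) b delta H) =
    delta * Num.sqrt (2 * beta * tau) * (1 + (s tau - 1)).
  by move=> tau0; rewrite valE//= DsE//; ring.
have rho_rel tau : 0 < tau -> rho H (z tau) =
    delta * Num.sqrt (beta / (2 * tau)) * (1 + ((s tau)^-1 - 1)).
  move=> tau0; rewrite rhoE// DsE// sqrt_beta_div//.
  by field; rewrite s0 ?r0.
have t_rel tau : 0 < tau -> t tau =
    delta * Num.sqrt (beta / (2 * tau)) * (1 + ((1 + tau / beta) / s tau - 1)).
  move=> tau0; rewrite tE// DsE// sqrt_beta_div//.
  by field; rewrite s0 ?r0 ?gt_eqF.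
have obj_rel tau : 0 < tau -> objective beta b (t tau, z tau) =
    delta * Num.sqrt (beta * tau / 2) * (1 + ((s tau)^-1 - 1)).
  move=> tau0; rewrite objE// DsE// sqrt_beta_mul//.
  by field; rewrite s0 ?r0.
have e_s tau : 0 < tau -> `|s tau - 1| <= tau / beta.
  exact: tilt_sqrt_error.
have e_sV tau : 0 < tau -> `|(s tau)^-1 - 1| <= tau / beta.
  exact: tilt_invsqrt_error.
have e_t tau : 0 < tau -> `|(1 + tau / beta) / s tau - 1| <= tau / beta.
  exact: tilt_ratio_error.
have mag_rate tau : 0 < tau -> delta * Num.sqrt (beta / (2 * tau)) =
    delta * Num.sqrt (beta / 2) * (Num.sqrt tau)^-1.
  by move=> tau0; rewrite sqrt_beta_div_split// mulrA.
split; try split; try split; try by [].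
- exact: relative_error_eq_mul val_rel e_s.
- exact: relative_error_eq_mul rho_rel e_sV.
- exact: relative_error_eq_mul t_rel e_t.
- exact: relative_error_eq_mul obj_rel e_sV.
- apply: (relative_error_bigO beta0 obj_rel e_sV (C := delta * Num.sqrt (beta / 2))).
  by move=> tau tau0; rewrite sqrt_beta_mul_split// mulrA.
- exact: (relative_error_bigO beta0 rho_rel e_sV mag_rate).
- exact: (relative_error_bigO beta0 t_rel e_t mag_rate).
Qed.
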